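(* Fix $L>0$. There exists $C>0$ such that the following holds. Let $u^0\in H^6(0,L)$ satisfy $u^0\in \mathrm{Dom}(P)$, $Pu^0\in\mathrm{Dom}(P)$ and $P^2u^0\in\mathrm{Dom}(P)$, and let $u$ be the solution of $\partial_t u=Pu$, $u(0)=u^0$, i.e. $u(t,x)=\sum_{p\ge 0}\alpha_p e^{-p^2\pi^2 t/L^2}c_p(x)$ with $\alpha_p=\langle u^0,c_p\rangle$. Let $J\ge 2$ and $\delta t\in(0,1)$ satisfy $\delta t/\delta x^2\le 1/2$, let $\mathsf v^0\in\mathbb R^J$ be arbitrary and $\mathsf v^{n+1}=(\mathrm{Id}+\delta t\,\mathsf P_\delta)\mathsf v^n$ for $n\ge0$. Then for all $n\ge 1$, $$\|\Pi_{\delta x}u(n\delta t)-\mathsf v^n\|_{\ell^2}\le \|\Pi_{\delta x}u^0-\mathsf v^0\|_{\ell^2}+C\Big(\delta x\sum_{p=1}^{\infty}|\alpha_p|p^4+\delta t\,\|P^2u^0\|_{H^1}\Big).$$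
   Context: $P=\partial_x^2$ on $(0,L)$ with homogeneous Neumann boundary conditions; $\mathrm{Dom}(P)=\{u\in L^2(0,L):\partial_x^2u\in L^2(0,L),\ \partial_xu(0)=\partial_xu(L)=0\}$. On $L^2(0,L)$ use the inner product $\langle u,v\rangle=\frac1L\int_0^Luv\,dx$, and set $c_0=1$, $c_p(x)=\sqrt2\cos(p\pi x/L)$ for $p\ge1$ (an orthonormal basis). For $J\ge2$: $\delta x=L/(J-1)$, $x_j=j\delta x$ for $0\le j\le J-1$; $\mathbb R^J$ carries the inner product $\langle \mathsf v,\mathsf w\rangle_\delta=\frac1J\sum_{j=0}^{J-1}\mathsf v_j\mathsf w_j$ with norm $\|\cdot\|_{\ell^2}$. $\Pi_{\delta x}w=(w(x_0),\dots,w(x_{J-1}))^\top$ for continuous $w$ on $[0,L]$. $\mathsf P_\delta$ is the $J\times J$ symmetric tridiagonal matrix $\frac1{\delta x^2}$ times the matrix with diagonal $(-1,-2,\dots,-2,-1)$ and all sub/super-diagonal entries equal to $1$. $H^1,H^s$ denote the standard Sobolev norms on $(0,L)$. *)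

(* Defs.v *)
From HB Require Import structures.
From mathcomp Require Import all_boot all_order all_algebra.
From mathcomp Require Import all_classical all_reals all_analysis.
Set Implicit Arguments. Unset Strict Implicit. Unset Printing Implicit Defensive.
Import Order.TTheory GRing.Theory Num.Theory.
Import numFieldNormedType.Exports.
Local Open Scope classical_set_scope.
Local Open Scope ring_scope.

Section Defs.
Variable R : realType.
Local Notation mu := (@lebesgue_measure R).

Definition I0L (L : R) : set R := `]0, L[.

Definition test_fun (L : R) (phi : R -> R) : Prop :=
  (forall (k : nat) (x : R), derivable (derive1n k phi) x 1) /\
  exists a b : R, [/\ 0 < a, a < b, b < L &
     forall x, x < a \/ b < x -> phi x = 0].

Definition L2 (L : R) (f : R -> R) : Prop :=
  measurable_fun (I0L L) f /\
  (\int[mu]_(x in I0L L) ((f x) ^+ 2)%:E < +oo)%E.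

Definition weak_deriv (L : R) (f g : R -> R) : Prop :=
  forall phi, test_fun L phi ->
    (\int[mu]_(x in I0L L) (f x * derive1 phi x)%:E =
     - \int[mu]_(x in I0L L) (g x * phi x)%:E)%E.

(* g 0 = f, and g 1, ..., g k are the successive weak derivatives of f,
   all in L^2(0,L): this says f \in H^k(0,L) with derivatives g. *)
Definition sobolev_chain (L : R) (k : nat) (g : nat -> R -> R) : Prop :=
  (forall i, (i <= k)%N -> L2 L (g i)) /\
  (forall i, (i < k)%N -> weak_deriv L (g i) (g i.+1)).

Definition H1norm (L : R) (f f' : R -> R) : R :=
  Num.sqrt (Rintegral mu (I0L L) (fun x => (f x) ^+ 2) +
            Rintegral mu (I0L L) (fun x => (f' x) ^+ 2)).

Definition cbasis (L : R) (p : nat) (x : R) : R :=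
  if p == 0%N then 1 else Num.sqrt 2 * cos (p%:R * pi * x / L).

Definition ip (L : R) (f g : R -> R) : R :=
  L^-1 * Rintegral mu (I0L L) (fun x => f x * g x).

Definition alpha (L : R) (u0 : R -> R) (p : nat) : R := ip L u0 (cbasis L p).

Definition heat_sol (L : R) (u0 : R -> R) (t x : R) : R :=
  limn (fun N => \sum_(0 <= p < N)
     alpha L u0 p * expR (- ((p%:R) ^+ 2 * pi ^+ 2 * t / L ^+ 2)) * cbasis L p x).

Definition dx_of (L : R) (J : nat) : R := L / (J.-1)%:R.

Definition Pi_dx (J : nat) (dx : R) (w : R -> R) : 'cV[R]_J :=
  \col_(j < J) w (j%:R * dx).

(* discrete Neumann Laplacian *)
Definition Pdelta (J : nat) (dx : R) : 'M[R]_J :=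
  \matrix_(i < J, j < J) ((dx ^+ 2)^-1 *
    (if (i : nat) == j then (if ((i : nat) == 0%N) || ((i : nat) == J.-1) then -1 else -2)
     else if ((i : nat).+1 == j) || ((j : nat).+1 == i) then 1 else 0)).

Definition l2norm (J : nat) (v : 'cV[R]_J) : R :=
  Num.sqrt (J%:R^-1 * \sum_(j < J) (v j ord0) ^+ 2).

End Defs.

(* Main.v *)
Require Import Defs.
From HB Require Import structures.
From mathcomp Require Import all_boot all_order all_algebra.
From mathcomp Require Import all_classical all_reals all_analysis.
From mathcomp Require Import ring lra zify.
Import Order.TTheory GRing.Theory Num.Theory.
Import numFieldNormedType.Exports.
Local Open Scope classical_set_scope.
Local Open Scope ring_scope.

(** The vectors [e_p], whose entries are the values of [c_p] at the midpoints
    [L (2 j + 1) / (2 J)], are eigenvectors of [Pdelta] for every [p >= 0], with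
    eigenvalue [- 4 / dx^2 * sin^2 (p pi / (2 J))]. A midpoint lies within [dx / 2]
    of the corresponding node, so the exact solution is compared, mode by mode,
    with the scheme started from the partial sums of [\sum_p alpha_p e_p]; the
    mismatch at time 0 costs [O (dx * \sum_p p |alpha_p|)], and since
    [1 + dt Pdelta] is doubly stochastic under the CFL condition, the scheme
    does not amplify it. In each mode, [exp (- n y)] and [(1 - z)^n] differ by
    [O (p dx)] uniformly in [n]: high frequencies [4 p > J] satisfy this trivially,
    and low ones decay exponentially in [n]. As [dt <= dx^2 / 2], the error
    committed in time is absorbed by the one committed in space.

    For continuous [u0] with summable [alpha], the cosine series has a continuous
    sum with the coefficients of [u0], hence equals [u0] pointwise: a continuous
    function orthogonal to all cosines vanishes, as otherwise powers of a quadratic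
    polynomial in [cos (pi x / L)] peaking where it is nonzero would give an
    unbounded integral. *)

(** * The explicit Euler step *)

(** Expanding the nonnegative sum of the squares [(B * a i - c * b i) ^+ 2] gives
    [B * (A * B - c ^+ 2)], and [B] cancels if positive. If [B = 0], every [b i] vanishes. *)
Lemma sum_CauchySchwarz (R : realFieldType) (I : finType) (a b : I -> R) :
  (\sum_i a i * b i) ^+ 2 <= (\sum_i a i ^+ 2) * \sum_i b i ^+ 2.
Proof.
set A := \sum_i a i ^+ 2; set B := \sum_i b i ^+ 2; set c := \sum_i a i * b i.
have B0 : 0 <= B by apply: sumr_ge0 => i _; exact: sqr_ge0.
have : 0 <= \sum_i (B * a i - c * b i) ^+ 2.
  by apply: sumr_ge0 => i _; exact: sqr_ge0.
have -> : \sum_i (B * a i - c * b i) ^+ 2 = B * (A * B - c ^+ 2).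
  transitivity (\sum_i (B ^+ 2 * a i ^+ 2 - (2 * B * c) * (a i * b i)
    + c ^+ 2 * b i ^+ 2)).
    by apply: eq_bigr => i _; ring.
  rewrite big_split /= sumrB -!mulr_sumr -/A -/B -/c; ring.
move: B0; rewrite le_eqVlt => /predU1P[B0 _|B0]; last first.
  by rewrite pmulr_rge0// subr_ge0.
have b0 i : b i = 0.
  apply/eqP; rewrite -sqrf_eq0; apply/eqP.
  by apply: (psumr_eq0P _ (esym B0)) => // k _; exact: sqr_ge0.
rewrite -B0 mulr0 /c big1 ?expr0n// => i _.
by rewrite b0 mulr0.
Qed.

Lemma l2normD (R : realType) (J : nat) (v w : 'cV[R]_J) :
  l2norm (v + w) <= l2norm v + l2norm w.
Proof.
rewrite /l2norm.
set A := \sum_j v j ord0 ^+ 2; set B := \sum_j w j ord0 ^+ 2.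
pose c := \sum_j v j ord0 * w j ord0.
have A0 : 0 <= A by apply: sumr_ge0 => i _; exact: sqr_ge0.
have B0 : 0 <= B by apply: sumr_ge0 => i _; exact: sqr_ge0.
have cAB : c <= Num.sqrt A * Num.sqrt B.
  rewrite -sqrtrM//; apply: le_trans (ler_norm c) _.
  by rewrite -sqrtr_sqr ler_sqrt ?mulr_ge0 ?sum_CauchySchwarz.
rewrite !sqrtrM ?invr_ge0 ?ler0n// -mulrDr ler_wpM2l ?sqrtr_ge0//.
have AB0 : 0 <= Num.sqrt A + Num.sqrt B by rewrite addr_ge0 ?sqrtr_ge0.
rewrite -(ger0_norm AB0) -sqrtr_sqr ler_sqrt ?sqr_ge0// sqrrD !sqr_sqrtr//.
have -> : \sum_j (v + w) j ord0 ^+ 2 = A + c *+ 2 + B.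
  rewrite -mulr_natr /A /B /c mulr_suml -!big_split /=.
  by apply: eq_bigr => j _; rewrite !mxE; ring.
by rewrite lerD2r lerD2l lerMn2r/= cAB.
Qed.

Lemma l2norm_le (R : realType) (J : nat) (v : 'cV[R]_J) (M : R) : 0 <= M ->
  (forall j, `|v j ord0| <= M) -> l2norm v <= M.
Proof.
move=> M0 vM; rewrite -(ger0_norm M0) -sqrtr_sqr ler_sqrt ?sqr_ge0//.
(* For [J = 0] the convention [0^-1 = 0] makes the norm zero. *)
case: (posnP J) => [J0|J0].
  by rewrite (_ : J%:R = 0) ?J0// invr0 mul0r sqr_ge0.
rewrite mulrC ler_pdivrMr ?ltr0n//.
apply: le_trans (ler_sum _ (_ : forall j, true -> _ <= M ^+ 2)) _.
  by move=> j _; rewrite -real_normK ?num_real// lerXn2r ?nnegrE.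
by rewrite sumr_const card_ord mulr_natr.
Qed.

(* Jensen's inequality in each row, then summation along the columns. *)
Lemma l2norm_doubly_stochastic (R : realType) (J : nat) (A : 'M[R]_J)
    (v : 'cV[R]_J) :
  (forall i j, 0 <= A i j) -> (forall i, \sum_j A i j = 1) ->
  (forall j, \sum_i A i j = 1) -> l2norm (A *m v) <= l2norm v.
Proof.
move=> A0 Ar Ac; rewrite ler_sqrt; last first.
  by rewrite mulr_ge0 ?invr_ge0// sumr_ge0// => i _; exact: sqr_ge0.
rewrite ler_wpM2l ?invr_ge0//.
apply: (@le_trans _ _ (\sum_i \sum_j A i j * v j ord0 ^+ 2)).
  apply: ler_sum => i _; rewrite mxE; set m := \sum_j _.
  rewrite -subr_ge0.
  have -> : \sum_j A i j * v j ord0 ^+ 2 - m ^+ 2 =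
            \sum_j A i j * (v j ord0 - m) ^+ 2.
    transitivity (\sum_j (A i j * v j ord0 ^+ 2 - (2 * m) * (A i j * v j ord0)
       + m ^+ 2 * A i j)); last by apply: eq_bigr => j _; ring.
    by rewrite big_split /= sumrB -!mulr_sumr -/m Ar; ring.
  by apply: sumr_ge0 => j _; rewrite mulr_ge0// sqr_ge0.
rewrite exchange_big /=; apply: ler_sum => j _.
by rewrite -mulr_suml Ac mul1r.
Qed.

(** Each diagonal entry is minus the number of neighbours of the node, so a row sums the differences
    to the neighbours that exist. Taking [w] on all of [nat] lets [i.+1] and [i.-1] be used without
    bounds. *)
Lemma Pdelta_mul (R : realType) (J : nat) (dx : R) (w : nat -> R) (i : 'I_J) :
  (2 <= J)%N ->
  (Pdelta J dx *m \col_j w j) i ord0 = (dx ^+ 2)^-1 *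
    ((if (i.+1 < J)%N then w i.+1 - w i else 0) +
     (if (0 < i)%N then w i.-1 - w i else 0)).
Proof.
move=> J2; rewrite mxE.
under eq_bigr => j _ do rewrite !mxE -mulrA.
rewrite -mulr_sumr; congr (_ * _).
transitivity (\sum_(j < J) ((i.+1 == j)%:R * w j + (j.+1 == i)%:R * w j
    - (i == j)%:R * (((i.+1 < J)%N%:R + (0 < i)%N%:R) * w i))).
  apply: eq_bigr => j _; rewrite -val_eqE /=.
  have ij := ltn_ord i; have jj := ltn_ord j.
  case: (eqVneq (nat_of_ord i) j) => [<-|ij'].
    rewrite !(gtn_eqF (ltnSn i)) /=.
    have [i0|i0] := eqVneq (nat_of_ord i) 0%N.
      by rewrite i0 /= J2 mulr1n; ring.
    rewrite lt0n i0 /=.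
    have -> : (i.+1 < J)%N = ((i : nat) != J.-1) by lia.
    by case: eqP => _ /=; rewrite ?mulr1n ?mulr0n; ring.
  have [h1|h1] := eqVneq i.+1 j => /=.
    by rewrite -h1 (gtn_eqF (_ : i < i.+2)%N) // ?mulr1n ?mulr0n; ring.
  by case: eqP => _ /=; rewrite ?mulr1n ?mulr0n; ring.
have pick (F : nat -> R) (k : nat) :
    (\sum_(j < J) (k == j :> nat)%:R * F j) = if (k < J)%N then F k else 0.
  case: ltnP => kJ.
    rewrite (bigD1 (Ordinal kJ))//= eqxx mul1r big1 ?addr0// => j jk.
    by rewrite -val_eqE /= eq_sym in jk; rewrite (negbTE jk) mul0r.
  by rewrite big1// => j _; rewrite gtn_eqF ?mul0r// (leq_trans (ltn_ord j)).
rewrite sumrB big_split /= (pick w).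
have -> : \sum_(j < J) (j.+1 == i)%:R * w j = if (0 < i)%N then w i.-1 else 0.
  have iJ := ltn_ord i.
  case: posnP => i0; first by rewrite big1// => j _; rewrite i0 /= mul0r.
  rewrite -[RHS](_ : (if (i.-1 < J)%N then w i.-1 else 0) = _); last first.
    by rewrite (_ : (i.-1 < J)%N)//; lia.
  rewrite -(pick w); apply: eq_bigr => j _.
  by rewrite (_ : (j.+1 == i) = (i.-1 == j))//; lia.
have -> : \sum_(j < J) (i == j)%:R * (((i.+1 < J)%N%:R + (0 < i)%N%:R) * w i)
   = ((i.+1 < J)%N%:R + (0 < i)%N%:R) * w i.
  rewrite -mulr_suml (bigD1 i)//= eqxx big1 ?addr0 ?mul1r// => j.
  by rewrite eq_sym => /negbTE ->.
by case: (i.+1 < J)%N; case: (0 < i)%N => /=; rewrite ?mulr1n ?mulr0n; ring.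
Qed.

Lemma Pdelta_sym (R : realType) (J : nat) (dx : R) (i j : 'I_J) :
  Pdelta J dx i j = Pdelta J dx j i.
Proof.
rewrite !mxE (eq_sym (j : nat)) (orbC (j.+1 == i)%N).
by case: eqP => // ->.
Qed.

Lemma Pdelta_row_sum (R : realType) (J : nat) (dx : R) (i : 'I_J) :
  (2 <= J)%N -> \sum_j Pdelta J dx i j = 0.
Proof.
move=> J2; have := @Pdelta_mul R J dx (fun=> 1) i J2.
rewrite !subrr !if_same addr0 mulr0 mxE => h; rewrite -[RHS]h.
by apply: eq_bigr => j _; rewrite [X in _ = _ * X]mxE mulr1.
Qed.

(** With [r = dt / dx ^+ 2] at most 1/2, the diagonal entries [1 - r] and [1 - 2 * r] are
    nonnegative. Rows sum to 1 because [Pdelta] annihilates constants, and symmetry carries this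
    over to columns. *)
Lemma l2norm_euler_step (R : realType) (J : nat) (dx dt : R) (v : 'cV[R]_J) :
  (2 <= J)%N -> 0 <= dt -> dt / dx ^+ 2 <= 2^-1 ->
  l2norm ((1%:M + dt *: Pdelta J dx) *m v) <= l2norm v.
Proof.
move=> J2 dt0 cfl.
have rs i : \sum_j (1%:M + dt *: Pdelta J dx) i j = 1.
  under eq_bigr => j _ do rewrite 3!mxE.
  rewrite big_split /= -mulr_sumr Pdelta_row_sum// mulr0 addr0.
  rewrite (bigD1 i)//= eqxx big1 ?addr0// => j.
  by rewrite eq_sym => /negbTE ->.
apply: l2norm_doubly_stochastic => // [i j|j].
  rewrite !mxE mulrA; set r := dt / _ in cfl *.
  have r0 : 0 <= r by rewrite divr_ge0// sqr_ge0.
  rewrite -val_eqE /=; case: eqP => _ /=; first by case: ifP => _; lra.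
  by case: ifP => _; lra.
rewrite -[RHS](rs j); apply: eq_bigr => i _.
rewrite [LHS]mxE [RHS]mxE; congr (_ + _); first by rewrite !mxE eq_sym.
by rewrite [LHS]mxE [RHS]mxE Pdelta_sym.
Qed.

(** * Decay of a single mode *)

Lemma cos_lipschitz (R : realType) (x y : R) : `|cos x - cos y| <= `|x - y|.
Proof.
wlog xy : x y / y <= x => [wlg|].
  have [/wlg//|/ltW/wlg] := leP y x.
  by rewrite distrC (distrC y).
have [c _ ->] := @MVT_segment R cos (fun x => - sin x) y x xy
  (fun x _ => is_derive_cos x) (continuous_subspaceT (@continuous_cos R)).
by rewrite normrM ler_piMl// normrN sin_max.
Qed.

Lemma cos_ge_parabola (R : realType) (x : R) : 1 - x ^+ 2 / 2 <= cos x.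
Proof.
have : cos x = 1 - 2 * sin (x / 2) ^+ 2.
  rewrite -[in LHS](@mulfVK _ 2 _ x)// mulr_natr cos_mulr2n cos2sin2 -mulr_natr.
  by ring.
move=> ->.
(* The sine is the cosine shifted by [pi / 2], and the cosine vanishes at [- (pi / 2)]. *)
have h : `|sin (x / 2)| <= `|x / 2|.
  have := cos_lipschitz R (x / 2 - pi / 2) (- (pi / 2)).
  by rewrite cosBpihalf cosN cos_pihalf subr0 opprK subrK.
have : sin (x / 2) ^+ 2 <= (x / 2) ^+ 2.
  by rewrite -(real_normK (num_real (sin _))) -(real_normK (num_real (x / 2))) lerXn2r ?nnegrE.
have := sqr_ge0 x.
rewrite exprMn; lra.
Qed.

(** By the mean value theorem [sin x = cos c * x] for some [c] between 0 and [x], and the parabola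
    below the cosine gives [cos c ^+ 2 >= (1 - x ^+ 2 / 2) ^+ 2 >= 1 - x ^+ 2]. *)
Lemma sin_sqr_bounds (R : realType) (x : R) : 0 <= x -> x <= 2^-1 ->
  x ^+ 2 * (1 - x ^+ 2) <= sin x ^+ 2 <= x ^+ 2.
Proof.
move=> x0 x1.
have [c /[!in_itv]/= /andP[c0 cx] h] := @MVT_segment R sin cos 0 x x0
  (fun x _ => is_derive_sin x) (continuous_subspaceT (@continuous_sin R)).
rewrite sin0 !subr0 in h; rewrite h exprMn.
have c2 : c ^+ 2 <= x ^+ 2 by rewrite lerXn2r ?nnegrE.
have x2 : x ^+ 2 <= 2^-1 ^+ 2 by rewrite lerXn2r ?nnegrE// invr_ge0.
have cosc : 1 - x ^+ 2 / 2 <= cos c.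
  by apply: le_trans (cos_ge_parabola _ c); lra.
have cosc1 := cos_le1 c.
have e4 : 2^-1 ^+ 2 = 4^-1 :> R by field.
rewrite e4 in x2.
have x20 := sqr_ge0 x.
rewrite mulrC; apply/andP; split; last first.
  by rewrite ler_piMl// expr_le1//; lra.
rewrite ler_wpM2r//.
apply: (@le_trans _ _ ((1 - x ^+ 2 / 2) ^+ 2)); first by have := sqr_ge0 (x ^+ 2); lra.
by rewrite lerXn2r ?nnegrE//; lra.
Qed.

(** The difference of powers is [a - b] times a sum of [n] products, each at most [m ^+ n.-1]. *)
Lemma ler_distX (R : realDomainType) (a b m : R) (n : nat) :
  0 <= a -> 0 <= b -> a <= m -> b <= m ->
  `|a ^+ n - b ^+ n| <= n%:R * m ^+ n.-1 * `|a - b|.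
Proof.
move=> a0 b0 am bm; have m0 := le_trans a0 am.
rewrite subrXX normrM mulrC ler_wpM2r//.
apply: le_trans (ler_norm_sum _ _ _) _.
apply: le_trans (ler_sum _ (_ : forall i, true -> _ <= m ^+ n.-1)) _.
  move=> i _; rewrite ger0_norm ?mulr_ge0 ?exprn_ge0//.
  have i_le : (i <= n.-1)%N by have := ltn_ord i; lia.
  rewrite -[X in m ^+ X](subnK i_le) exprD.
  rewrite -subn1 subnAC subn1.
  by apply: ler_pM; rewrite ?exprn_ge0// lerXn2r ?nnegrE.
by rewrite sumr_const card_ord mulr_natl.
Qed.

(* The decay [m ^ (n - 1)] with [m = exp (- y / 4)] absorbs the factor [n] of
   the telescoped power difference, so the bound is uniform in [n]. *)
Lemma euler_expR_dist (R : realType) (y z q : R) (n : nat) :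
  0 <= y -> y <= 1 -> y / 4 <= z -> z <= y -> y - z <= y * q -> y <= q ->
  `|expR (- y) ^+ n - (1 - z) ^+ n| <= 5 * q.
Proof.
move=> y0 y1 yz zy yzq yq.
case: n => [|n]; first by rewrite !expr0 subrr normr0; lra.
set a := expR (- y); set b := 1 - z; pose m := expR (- (y / 4)).
have a0 : 0 <= a by exact: expR_ge0.
have b0 : 0 <= b by rewrite /b; lra.
have am : a <= m by rewrite ler_expR; lra.
have bm : b <= m by apply: le_trans (expR_ge1Dx _); rewrite /b; lra.
have ay : 1 - y <= a by exact: expR_ge1Dx.
have ay' : a <= 1 - y + y ^+ 2.
  rewrite /a expRN -div1r ler_pdivrMr ?expR_gt0//.
  have := expR_ge1Dx y; set E := expR y => hE.
  have hy : 0 <= 1 - y + y ^+ 2 by have := sqr_ge0 y; lra.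
  apply: (@le_trans _ _ ((1 - y + y ^+ 2) * (1 + y))); last by rewrite ler_wpM2l.
  have -> : (1 - y + y ^+ 2) * (1 + y) = 1 + y ^+ 3 by ring.
  by rewrite lerDl exprn_ge0.
have yy : y ^+ 2 <= y * q by rewrite expr2 ler_wpM2l.
(* The lower bound comes from [y - z <= y * q], the upper one from [z <= y] and
   [y ^+ 2 <= y * q]. *)
have ab : `|a - b| <= y * q by rewrite ler_norml /b; lra.
apply: le_trans (ler_distX _ _ _ _ n.+1 a0 b0 am bm) _ => /=.
(* Since [expR (n * y / 4) >= 1 + n * y / 4], the product [n * y * m ^+ n] is at most 4; passing
   from [n] to [n.+1] adds at most 1. *)
have nm : n.+1%:R * m ^+ n * y <= 5.
  have m1 : m ^+ n <= 1 by rewrite exprn_ile1 ?expR_ge0// -expR0 ler_expR; lra.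
  have mn0 : 0 <= m ^+ n by rewrite exprn_ge0// expR_ge0.
  suff h : n%:R * y * m ^+ n <= 4.
    have : y * m ^+ n <= 1 by rewrite mulr_ile1.
    rewrite -natr1; lra.
  rewrite -expRM_natr mulNr expRN ler_pdivrMr ?expR_gt0//.
  have := expR_ge1Dx (y / 4 * n%:R).
  lra.
apply: (@le_trans _ _ (n.+1%:R * m ^+ n * (y * q))).
  by rewrite ler_wpM2l// mulr_ge0// exprn_ge0// expR_ge0.
rewrite mulrA ler_wpM2r//; lra.
Qed.

Lemma pi_le4 (R : realType) : pi <= 4 :> R.
Proof. by have := @pihalf_lt2 R; lra. Qed.

Lemma mode_decay_dist (R : realType) (r : R) (p K n : nat) :
  0 <= r -> r <= 2^-1 -> (0 < p)%N -> (0 < K)%N ->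
  `|expR (- (r * (p%:R * pi / K%:R) ^+ 2)) ^+ n -
    (1 - 4 * r * sin (p%:R * pi / (2 * K.+1%:R)) ^+ 2) ^+ n|
  <= 15 * (p%:R / K%:R).
Proof.
move=> r0 r1 p0 K0.
set th := p%:R * pi / (2 * _).
set y := r * _ ^+ 2; set z := _ * sin th ^+ 2.
have pi4 := @pi_le4 R; have pi0 := @pi_ge0 R.
have Kp : 0 < K%:R :> R by rewrite ltr0n.
have K1p : 0 < K%:R + 1 :> R by lra.
have p1 : 1 <= p%:R :> R by rewrite ler1n.
have y0 : 0 <= y by rewrite mulr_ge0// sqr_ge0.
have K1E : K.+1%:R = K%:R + 1 :> R by rewrite -natr1.
(* At high frequency the right-hand side is at least 2, while both powers have absolute value at
   most 1. *)
have [Kp4|Kp4] := ltnP K.+1 (4 * p).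
  have q1 : 2 <= 15 * (p%:R / K%:R) :> R.
    rewrite mulrA ler_pdivlMr// -!natrM ler_nat; lia.
  have s0 := sqr_ge0 (sin th); have s1 : sin th ^+ 2 <= 1.
    by rewrite sin2cos2; have := sqr_ge0 (cos th); lra.
  have z0 : 0 <= z by rewrite /z mulr_ge0// mulr_ge0.
  have z2 : z <= 2.
    have : r * sin th ^+ 2 <= 2^-1 by rewrite -[leRHS]mulr1 ler_pM.
    by rewrite /z; lra.
  apply: le_trans q1; apply: le_trans (ler_normB _ _) _.
  rewrite (_ : 2 = 1 + 1)//; apply: lerD.
    by rewrite normrX exprn_ile1// ger0_norm ?expR_ge0// -expR0 ler_expR; lra.
  by rewrite normrX exprn_ile1// ler_norml; lra.
rewrite (_ : 15 * (p%:R / K%:R) = 5 * (3 * (p%:R / K%:R))); last by ring.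
have Kp4' : 4 * p%:R <= K%:R + 1 :> R by rewrite -natrM natr1 ler_nat.
set t := p%:R / K%:R; pose s : R := p%:R / (K%:R + 1).
have t0 : 0 <= t by rewrite divr_ge0.
have t1 : 3 * t <= 1 by rewrite mulrA ler_pdivrMr//; lra.
have s0 : 0 <= s by rewrite divr_ge0// ltW.
have s4 : 4 * s <= 1 by rewrite mulrA ler_pdivrMr//; lra.
have st : s <= t by rewrite ler_wpM2l// lef_pV2 ?posrE//; lra.
have k1 : (K%:R + 1)^-1 <= s by rewrite -[leLHS]mul1r ler_wpM2r// invr_ge0 ltW.
have k0 : 0 <= (K%:R + 1)^-1 :> R by rewrite invr_ge0 ltW.
have thE : th = s * (pi / 2) by rewrite /th /s K1E; field; rewrite gt_eqF.
have th0 : 0 <= th by rewrite thE mulr_ge0// divr_ge0.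
have th1 : th <= 2 * s by rewrite thE mulrC ler_wpM2r//; lra.
have th12 : th <= 2^-1 by lra.
have /andP[sl su] := sin_sqr_bounds _ _ th0 th12.
(* The discrete angle is built on [J = K + 1] cells, but the mesh width on [K]; the mismatch is this
   last factor. *)
have phE : (2 * th) ^+ 2 = (p%:R * pi / K%:R) ^+ 2 * (1 - (K%:R + 1)^-1) ^+ 2.
  by rewrite /th K1E; field; rewrite !gt_eqF.
set f2 := (p%:R * pi / K%:R) ^+ 2 in y y0 phE *.
have f20 : 0 <= f2 by exact: sqr_ge0.
have f2E : f2 <= 16 * t ^+ 2.
  rewrite /f2 (_ : p%:R * pi / K%:R = pi * t); last by rewrite /t; ring.
  rewrite exprMn ler_wpM2r ?sqr_ge0// (_ : 16 = 4 ^+ 2); last by ring.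
  by rewrite lerXn2r ?nnegrE.
have th2 : th ^+ 2 <= s.
  have : th ^+ 2 <= 2^-1 * (2 * s) by rewrite expr2 ler_pM.
  lra.
set k := (K%:R + 1)^-1 in k1 k0 phE.
have zy : z <= y.
  have : 4 * sin th ^+ 2 <= f2.
    apply: (@le_trans _ _ ((2 * th) ^+ 2)); first by rewrite exprMn; lra.
    by rewrite phE ler_piMr// exprn_ile1//; lra.
  by move=> /(ler_wpM2l r0); rewrite /z /y; lra.
(* The mismatch of denominators costs a factor at least [1 - 2 * s], because [k <= s], and the sine
   a factor at least [1 - s]; their product is at least [1 - 3 * s]. *)
have zy' : y - z <= y * (3 * s).
  suff : f2 * (1 - 3 * s) <= 4 * sin th ^+ 2.
    by move=> /(ler_wpM2l r0); rewrite /z /y; lra.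
  apply: (@le_trans _ _ ((2 * th) ^+ 2 * (1 - th ^+ 2))); last first.
    have -> : (2 * th) ^+ 2 = 4 * th ^+ 2 by ring.
    lra.
  rewrite phE -mulrA ler_wpM2l//.
  apply: (@le_trans _ _ ((1 - 2 * s) * (1 - s))).
    have := sqr_ge0 s; lra.
  apply: ler_pM; try lra.
  have := sqr_ge0 k; lra.
(* As [3 * t <= 1], this puts [y] below both 1 and [3 * t], the value of [q] in
   [euler_expR_dist]. *)
have yt : y <= 8 * t ^+ 2.
  apply: (@le_trans _ _ (2^-1 * (16 * t ^+ 2))); last by lra.
  by rewrite /y ler_pM.
have tt : t * (3 * t) <= t * 1 by rewrite ler_wpM2l.
have y1 : y <= 1 by lra.
apply: euler_expR_dist => //; try lra.
- have : y * (4 * s) <= y * 1 by rewrite ler_wpM2l.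
  lra.
- by apply: le_trans zy' _; rewrite ler_wpM2l//; lra.
Qed.

Lemma sin_natr_pi (R : realType) (n : nat) : sin (n%:R * pi) = 0 :> R.
Proof.
elim: n => [|n IH]; first by rewrite mul0r sin0.
by rewrite -natr1 mulrDl mul1r sinD sinpi cospi IH mul0r mulr0 addr0.
Qed.

(** * Pointwise convergence of cosine series *)

Lemma within_continuousM (R : realType) (A : set R) (f g : R -> R) :
  {within A, continuous f} -> {within A, continuous g} ->
  {within A, continuous (fun x => f x * g x)}.
Proof. by move=> cf cg x; apply: continuousM; [exact: cf|exact: cg]. Qed.

Lemma within_continuous_lin (R : realType) (A : set R) (f g : R -> R) (a b : R) :
  {within A, continuous f} -> {within A, continuous g} ->
  {within A, continuous (fun x => a * f x + b * g x)}.
Proof.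
move=> cf cg; apply: (@within_continuousD _ _ _ _ (fun x => a * f x)).
- by apply: within_continuousM => // x; exact: cst_continuous.
- by apply: within_continuousM => // x; exact: cst_continuous.
Qed.

Local Notation Int L f := (Rintegral (@lebesgue_measure _) (I0L L) f).

Lemma integrable_I0L (R : realType) (L : R) (f : R -> R) :
  {within `[0, L], continuous f} ->
  (@lebesgue_measure R).-integrable (I0L L) (EFin \o f).
Proof.
move=> cf.
have := continuous_compact_integrable (@segment_compact R 0 L) cf.
apply: integrableS; [exact: measurable_itv|exact: measurable_itv|].
exact: subset_itv_oo_cc.
Qed.

Lemma Int_lin (R : realType) (L : R) (f g : R -> R) (a b : R) :
  {within `[0, L], continuous f} -> {within `[0, L], continuous g} ->
  Int L (fun x => a * f x + b * g x) = a * Int L f + b * Int L g.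
Proof.
move=> cf cg; have mI : measurable (I0L L) by exact: measurable_itv.
have cM (c : R) (k : R -> R) : {within `[0, L], continuous k} ->
    {within `[0, L], continuous (fun x => c * k x)}.
  by move=> ck; apply: within_continuousM => // x; exact: cst_continuous.
rewrite RintegralD//; [|exact/integrable_I0L/cM..].
by rewrite !RintegralZl//; exact: integrable_I0L.
Qed.

Lemma Int_cst (R : realType) (L c : R) : 0 < L -> Int L (fun=> c) = c * L.
Proof.
move=> L0; rewrite Rintegral_cst; last exact: measurable_itv.
have := @lebesgue_measure_itv R `]0, L[.
by rewrite /= lte_fin L0 oppr0 adde0 => h; rewrite -[in RHS](_ : fine (lebesgue_measure (I0L L)) = L) // [X in fine X = _]h.
Qed.

Lemma Int_le (R : realType) (L : R) (f g : R -> R) :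
  {within `[0, L], continuous f} -> {within `[0, L], continuous g} ->
  (forall x, 0 < x -> x < L -> f x <= g x) -> Int L f <= Int L g.
Proof.
move=> cf cg fg; apply: le_Rintegral; [exact: measurable_itv|exact: integrable_I0L..|].
by move=> x; rewrite /I0L /= in_itv /= => /andP[x0 xL]; exact: fg.
Qed.

Definition cosk {R : realType} (L : R) (k : nat) (x : R) : R :=
  cos (k%:R * pi * x / L).

Lemma cosk_continuous (R : realType) (L : R) (k : nat) (A : set R) :
  {within A, continuous (cosk L k)}.
Proof.
apply: continuous_subspaceT => x; apply: continuous_comp; last exact: continuous_cos.
apply: continuousM; last exact: cst_continuous.
by apply: continuousM; [exact: cst_continuous|exact: cvg_id].
Qed.

(** The product-to-sum formula; [maxn p k - minn p k] is the distance of [p] and [k] as a natural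
    number. *)
Lemma coskM (R : realType) (L : R) (p k : nat) (x : R) :
  cosk L p x * cosk L k x =
  2^-1 * cosk L (p + k) x + 2^-1 * cosk L (maxn p k - minn p k) x.
Proof.
wlog pk : p k / (k <= p)%N => [wlg|].
  case/orP: (leq_total k p) => /wlg//.
  by rewrite mulrC addnC (maxnC p) (minnC p).
rewrite (maxn_idPl pk) (minn_idPr pk) /cosk natrB// natrD.
rewrite !(mulrDl, mulNr) cosD cosB.
lra.
Qed.

Lemma Int_cosk (R : realType) (L : R) (k : nat) : 0 < L ->
  Int L (cosk L k) = (k == 0%N)%:R * L.
Proof.
move=> L0; case: k => [|k].
  rewrite -Int_cst//; apply: eq_Rintegral => x _.
  by rewrite /cosk !mul0r cos0.
rewrite mul0r.
(* The antiderivative [c^-1 * sin (c * x)] vanishes at both ends, since [c * L] is a multiple of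
   [pi]. *)
pose c : R := k.+1%:R * pi / L.
have c0 : c != 0 by rewrite mulf_neq0// ?mulf_neq0// ?invr_eq0 ?gt_eqF ?pi_gt0.
have cE x : k.+1%:R * pi * x / L = c * x by rewrite /c; ring.
have dF (x : R) : is_derive x 1 (fun x : R => c^-1 * sin (c * x)) (cosk L k.+1 x).
  apply: is_derive_eq.
  by rewrite /cosk cE /GRing.scale /=; field.
have cF : continuous (fun x : R => c^-1 * sin (c * x)).
  by move=> x; apply: differentiable_continuous; apply/derivable1_diffP.
have := @continuous_FTC2 R (cosk L k.+1) (fun x => c^-1 * sin (c * x)) 0 L L0
  (cosk_continuous _ _ _ _).
have -> : Int L (cosk L k.+1) =
  Rintegral (@lebesgue_measure R) `[0, L] (cosk L k.+1).
  rewrite /I0L.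
  rewrite Rintegral_itv_obnd_cbnd; last exact/integrable_I0L/cosk_continuous.
  rewrite Rintegral_itv_bndo_bndc//.
  have := continuous_compact_integrable (@segment_compact R 0 L)
    (cosk_continuous _ L k.+1 _).
  apply: integrableS; [exact: measurable_itv|exact: measurable_itv|].
  by move=> x /=; rewrite !in_itv /= => /andP[-> /ltW].
rewrite /Rintegral => ->.
- rewrite mulr0 sin0 mulr0 /= subr0 -cE mulfK ?gt_eqF//.
  by rewrite sin_natr_pi mulr0.
- split=> [x _||].
  + exact/derivable1_diffP/derivable1_diffP.
  + exact/cvg_at_right_filter/cF.
  + exact/cvg_at_left_filter/cF.
- by move=> x _; rewrite derive1E derive_val.
Qed.

(** * Continuous functions orthogonal to all cosines *)

Definition cos_orth {R : realType} (L : R) (f : R -> R) :=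
  {within `[0, L], continuous f} /\
  forall k, Int L (fun x => f x * cosk L k x) = 0.

Lemma cos_orth_lin (R : realType) (L : R) (f g : R -> R) (a b : R) :
  cos_orth L f -> cos_orth L g -> cos_orth L (fun x => a * f x + b * g x).
Proof.
move=> [cf f0] [cg g0]; split; first exact: within_continuous_lin.
move=> k; transitivity (Int L (fun x => a * (f x * cosk L k x) + b * (g x * cosk L k x))).
  by apply: eq_Rintegral => x _; ring.
rewrite Int_lin; [|apply: within_continuousM => //; exact: cosk_continuous..].
by rewrite f0 g0 !mulr0 addr0.
Qed.

(** By the product-to-sum formula the new factor only shifts frequencies. Together with linearity,
    this allows multiplication by any polynomial in [cosk L 1]. *)
Lemma cos_orthM (R : realType) (L : R) (f : R -> R) :
  cos_orth L f -> cos_orth L (fun x => f x * cosk L 1 x).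
Proof.
move=> [cf f0]; split; first exact/within_continuousM/cosk_continuous.
move=> k; transitivity (Int L (fun x => 2^-1 * (f x * cosk L (1 + k) x) +
    2^-1 * (f x * cosk L (maxn 1 k - minn 1 k) x))).
  by apply: eq_Rintegral => x _; rewrite -mulrA coskM; ring.
rewrite Int_lin; [|apply: within_continuousM => //; exact: cosk_continuous..].
by rewrite !f0 !mulr0 addr0.
Qed.

Lemma within_continuous_dist (R : realType) (A : set R) (f : R -> R) (x e : R) :
  {within A, continuous f} -> A x -> 0 < e ->
  exists2 d, 0 < d & forall y, A y -> `|x - y| < d -> `|f x - f y| < e.
Proof.
move=> /subspace_continuousP cf Ax e0.
have /cvgrPdist_lt /(_ e e0) := cf x Ax.
rewrite near_withinE => /nbhs_ballP[d /= d0 H].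
by exists d => // y Ay xy; exact: (H y).
Qed.

Lemma Int_gt0 (R : realType) (L x0 : R) (f : R -> R) : 0 < L ->
  {within `[0, L], continuous f} -> (forall x, 0 <= f x) ->
  0 <= x0 <= L -> 0 < f x0 -> 0 < Int L f.
Proof.
move=> L0 cf f0 x0L fx0.
have x0A : `[0, L]%classic x0 by rewrite /= in_itv.
have /(within_continuous_dist _ _ _ _ _ cf x0A)[d d0 Hd] : 0 < f x0 / 2 by rewrite divr_gt0.
move/andP : x0L => [x00 x0L].
(* Clipping to the segment leaves positive length even if [x0] is an endpoint; on this interval [f]
   exceeds [f x0 / 2]. *)
pose a := Num.max 0 (x0 - d / 2); pose b := Num.min L (x0 + d / 2).
have ab : a < b by rewrite /a /b gt_max !lt_min; apply/andP; split; apply/andP; split; lra.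
have a0 : 0 <= a by rewrite le_max lexx.
have ad : x0 - d / 2 <= a by rewrite le_max lexx orbT.
have bL : b <= L by rewrite ge_min lexx.
have bd : b <= x0 + d / 2 by rewrite ge_min lexx orbT.
have sub : `]a, b[%classic `<=` I0L L.
  move=> x; rewrite /I0L /= !in_itv /= => /andP[ax xb].
  by rewrite (le_lt_trans a0)//= (lt_le_trans xb).
have iab (k : R -> R) : {within `[0, L], continuous k} ->
    (@lebesgue_measure R).-integrable `]a, b[%classic (EFin \o k).
  move=> /integrable_I0L; apply: integrableS => //; exact: measurable_itv.
have h1 : Rintegral lebesgue_measure `]a, b[%classic f <= Int L f.
  apply: fine_le.
  - by apply: integrable_fin_num; [exact: measurable_itv|exact: iab].
  - by apply: integrable_fin_num; [exact: measurable_itv|exact: integrable_I0L].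
  apply: ge0_subset_integral => //.
  - exact: measurable_itv.
  - exact: (measurable_int _ (integrable_I0L _ _ _ cf)).
  - by move=> x _; rewrite lee_fin.
apply: lt_le_trans h1.
apply: (@lt_le_trans _ _ (Rintegral lebesgue_measure `]a, b[%classic (fun=> f x0 / 2))).
  rewrite Rintegral_cst; last exact: measurable_itv.
  have := @lebesgue_measure_itv R `]a, b[.
  rewrite /= lte_fin ab => h.
  by rewrite [X in fine X]h /= mulr_gt0 ?subr_gt0// divr_gt0.
apply: le_Rintegral; [exact: measurable_itv|apply: iab|exact: iab|].
  by move=> x; exact: cst_continuous.
move=> x; rewrite /= in_itv /= => /andP[ax xb].
have xA : `[0, L]%classic x by rewrite /= in_itv /=; apply/andP; split; lra.
have : `|x0 - x| < d by rewrite ltr_norml; lra.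
by move/(Hd x xA); rewrite ltr_norml; lra.
Qed.

(** In the induction, multiplying by [x] leaves a surplus [n * (x - 1) ^+ 2]. *)
Lemma bernoulli_le (R : realFieldType) (x : R) (n : nat) : 0 <= x ->
  1 + n%:R * (x - 1) <= x ^+ n.
Proof.
move=> x0; elim: n => [|n IH]; first by rewrite expr0; lra.
have := ler_wpM2l x0 IH; rewrite exprS -natr1.
have := mulr_ge0 (ler0n R n) (sqr_ge0 (x - 1)); lra.
Qed.

(* [q] exceeds [1] only where [h] is positive, so [Int (h * q ^ n)] grows
   linearly in [n] although it is [0]. *)
Lemma cos_orth_le0 (R : realType) (L : R) (h : R -> R) (x0 : R) : 0 < L ->
  cos_orth L h -> 0 <= x0 <= L -> h x0 <= 0.
Proof.
move=> L0 oh x0L; rewrite leNgt; apply/negP => hx0.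
have ch := oh.1.
have x0A : `[0, L]%classic x0 by rewrite /= in_itv.
set c := h x0 / 2; have c0 : 0 < c by rewrite divr_gt0.
have [d d0 Hd] := within_continuous_dist _ _ _ _ _ ch x0A c0.
have pos x : 0 <= x <= L -> `|x0 - x| < d -> c <= h x.
  move=> xL /Hd; rewrite /= in_itv /= => /(_ xL).
  by rewrite ltr_norml /c; lra.
pose y := cosk L 1; set y0 := y x0.
have cosm x x' : 0 <= x <= L -> 0 <= x' <= L -> x < x' -> y x' < y x.
  move=> /andP[x1 x2] /andP[x3 x4] xx'.
  have e z : 1%:R * pi * z / L = pi * (z / L) by rewrite mul1r mulrA.
  have itv z : 0 <= z -> z <= L -> pi * (z / L) \in `[0, pi].
    move=> z0 zL; rewrite in_itv /= mulr_ge0 ?pi_ge0 ?divr_ge0//=; last exact: ltW.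
    by rewrite ler_piMr ?pi_ge0// ler_pdivrMr// mul1r.
  rewrite /y /cosk !e ltr_cos ?itv// ltr_pM2l ?pi_gt0// ltr_pM2r ?invr_gt0//.
have /andP[x00 x0L'] := x0L.
(* As [y] is strictly decreasing, its distance to [y0] is smallest at [x0 - d] or [x0 + d]. If one
   of these leaves the segment, that side is empty and 1 serves as bound. *)
have [eta [eta0 Heta]] : exists eta : R, 0 < eta /\
    forall x, 0 <= x <= L -> d <= `|x0 - x| -> eta <= `|y x - y0|.
  have [e1 e10 H1] : exists2 e : R, 0 < e &
      forall x, 0 <= x <= L -> x <= x0 - d -> e <= y x - y0.
    have [hd|hd] := leP 0 (x0 - d); last first.
      by exists 1 => // x /andP[? ?] ?; exfalso; lra.
    exists (y (x0 - d) - y0).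
      by rewrite subr_gt0; apply: cosm => //; lra.
    move=> x xL; rewrite lerD2r le_eqVlt => /predU1P[->//|xx]; apply: ltW.
    by apply: cosm => //; lra.
  have [e2 e20 H2] : exists2 e : R, 0 < e &
      forall x, 0 <= x <= L -> x0 + d <= x -> e <= y0 - y x.
    have [hd|hd] := leP (x0 + d) L; last first.
      by exists 1 => // x /andP[? ?] ?; exfalso; lra.
    exists (y0 - y (x0 + d)).
      by rewrite subr_gt0; apply: cosm => //; lra.
    move=> x xL; rewrite lerD2l lerN2 le_eqVlt => /predU1P[->//|xx]; apply: ltW.
    by apply: cosm => //; lra.
  exists (Num.min e1 e2); split; first by rewrite lt_min e10.
  move=> x xL; rewrite ge_min real_ler_normr ?num_real// => /orP[xd|xd].
    by rewrite (le_trans (H1 x xL _)) ?ler_norm//; lra.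
  rewrite distrC (le_trans (H2 x xL _)) ?ler_norm ?orbT//; lra.
(* The divisor 4 keeps [q] nonnegative, as [y] ranges in [-1, 1]; the term [eta ^+ 2 / 8] lifts
   [q x0] above 1 yet is outweighed by [eta ^+ 2 / 4] at distance [d] or more. *)
pose q x := 1 + eta ^+ 2 / 8 - (y x - y0) ^+ 2 / 4.
have qE x : q x = 1 * ((1 + eta ^+ 2 / 8 - y0 ^+ 2 / 4) * 1 + y0 / 2 * y x)
    + - 4^-1 * (y x * y x).
  by rewrite /q; field.
have ybnd x : -1 <= y x <= 1 by rewrite cos_geN1 cos_le1.
have y4 x : (y x - y0) ^+ 2 <= 4.
  have -> : 4 = 2 ^+ 2 :> R by ring.
  rewrite -real_normK ?num_real// lerXn2r ?nnegrE//.
  have := ybnd x; have := ybnd x0; rewrite -/y0 ler_norml; lra.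
have e2 : 0 < eta ^+ 2 by rewrite exprn_gt0.
have q0 x : 0 <= q x by rewrite /q; have := y4 x; lra.
have q1 x : 0 <= x <= L -> d <= `|x0 - x| -> q x <= 1.
  move=> xL xd; have he : eta ^+ 2 <= (y x - y0) ^+ 2.
    rewrite -[leRHS]real_normK ?num_real// lerXn2r ?nnegrE ?(ltW eta0)//.
    exact: Heta.
  by rewrite /q; lra.
have oq n : cos_orth L (fun x => h x * q x ^+ n).
  elim: n => [|n IH].
    by rewrite (_ : (fun x => _) = h)//; apply/funext => x; rewrite expr0 mulr1.
  have o1 := cos_orthM _ _ _ IH; have o2 := cos_orthM _ _ _ o1.
  have := cos_orth_lin _ _ _ _ 1 (- 4^-1)
    (cos_orth_lin _ _ _ _ (1 + eta ^+ 2 / 8 - y0 ^+ 2 / 4) (y0 / 2) IH o1) o2.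
  congr cos_orth; apply/funext => x; rewrite (exprS (q x)); set t := q x ^+ n.
  by rewrite qE /y; ring.
have c1 : {within `[0, L], continuous (fun=> 1 : R)}.
  by move=> x; exact: cst_continuous.
have cq : {within `[0, L], continuous q}.
  have cy := cosk_continuous R L 1 `[0, L]%classic.
  have := within_continuous_lin _ _ _ _ 1 (- 4^-1)
    (within_continuous_lin _ _ _ _ (1 + eta ^+ 2 / 8 - y0 ^+ 2 / 4) (y0 / 2) c1 cy)
    (within_continuousM _ _ _ _ cy cy).
  by rewrite (_ : (fun x => 1 * _ + _) = q)//; apply/funext => x; rewrite qE.
(* This is [c] times the positive part of [q - 1]. *)
pose psi x := c / 2 * (q x - 1 + `|q x - 1|).
have cq1 : {within `[0, L], continuous (q - (fun=> 1))}.
  exact: within_continuousB.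
have cpsi : {within `[0, L], continuous psi}.
  apply: within_continuousM; first by move=> x; exact: cst_continuous.
  apply: (@within_continuousD _ _ _ _ (q - (fun=> 1)) (fun x => `|q x - 1|)) => //.
  by move=> x; apply: cvg_norm; exact: cq1.
have psi0 x : 0 <= psi x.
  by rewrite mulr_ge0 ?divr_ge0 ?(ltW c0)//; have := ler_norm (- (q x - 1)); rewrite normrN; lra.
have Ipsi : 0 < Int L psi.
  apply: (Int_gt0 _ _ x0) => //.
  have q1x0 : 1 < q x0 by rewrite /q subrr expr0n /= mul0r; lra.
  by rewrite mulr_gt0 ?divr_gt0// addr_gt0 ?normr_gt0 ?subr_gt0// gt_eqF// subr_gt0.
have [M M0 HM] : exists2 M : R, 0 <= M & forall x, 0 <= x <= L -> - M <= h x.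
  have := @EVT_min R h 0 L (ltW L0) ch => -[z _ Hz].
  exists `|h z|; first exact: normr_ge0.
  move=> x xL; apply: le_trans (Hz x _); last by rewrite in_itv.
  by rewrite lerNl -normrN ler_norm.
(* Pointwise [n * psi - M <= h * q ^+ n]. Near [x0] this is [c <= h] with Bernoulli's inequality;
   farther away [psi] vanishes, [q ^+ n <= 1] and [- M <= h]. *)
have key n : n%:R * Int L psi - M * L <= 0.
  have -> : n%:R * Int L psi - M * L = n%:R * Int L psi + (- 1) * Int L (fun=> M).
    by rewrite (Int_cst _ _ M L0) mulN1r.
  have cM : {within `[0, L], continuous (fun=> M)} by move=> x; exact: cst_continuous.
  have [chq /(_ 0%N) hq0] := oq n.
  have <- : Int L (fun x => h x * q x ^+ n) = 0.
    rewrite -[RHS]hq0; apply: eq_Rintegral => x _.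
    by rewrite /cosk !mul0r cos0 mulr1.
  rewrite -Int_lin//; apply: Int_le => //; first exact: within_continuous_lin.
  move=> x xp xL; have xL' : 0 <= x <= L by rewrite !ltW.
  have qn0 : 0 <= q x ^+ n by rewrite exprn_ge0.
  have [xd|xd] := leP d `|x0 - x|.
    have qx1 := q1 x xL' xd.
    rewrite /psi ler0_norm ?subr_le0// subrr mulr0.
    have : q x ^+ n <= 1 by rewrite exprn_ile1.
    move=> qn1; have := ler_wpM2r qn0 (HM x xL').
    have := ler_wpM2l M0 qn1; lra.
  have hc := pos x xL' xd.
  have hq := ler_wpM2r qn0 hc.
  rewrite /psi; have [q1x|q1x] := leP (q x) 1.
    rewrite ler0_norm ?subr_le0// subrr mulr0.
    have := mulr_ge0 (ltW c0) qn0; lra.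
  rewrite gtr0_norm ?subr_gt0//.
  have := ler_wpM2l (ltW c0) (bernoulli_le _ _ n (q0 x)); lra.
have := archi_boundP (divr_ge0 (mulr_ge0 M0 (ltW L0)) (ltW Ipsi)).
have := key (Num.bound ((M * L) / Int L psi)).
by rewrite subr_le0 leNgt ltr_pdivrMr// => /negP.
Qed.

Lemma cos_orth_eq0 (R : realType) (L : R) (h : R -> R) (x : R) : 0 < L ->
  cos_orth L h -> 0 <= x <= L -> h x = 0.
Proof.
move=> L0 oh xL; apply/eqP; rewrite eq_le (cos_orth_le0 R L)//=.
have := cos_orth_le0 _ _ _ x L0 (cos_orth_lin _ _ _ _ (-1) 0 oh oh) xL.
lra.
Qed.

(** * Summation of the cosine series *)

(** The tail bound involves [b] alone, so it is uniform over a family of series with a common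
    majorant. *)
Lemma series_dominated (R : realType) (a b : R^nat) :
  (forall p, `|a p| <= b p) -> cvgn (series b) ->
  cvgn (series a) /\
  forall N, `|limn (series a) - series a N| <= limn (series b) - series b N.
Proof.
move=> ab cb.
have ca : cvgn (series a).
  apply: normed_cvg; apply: (@series_le_cvg _ (fun p => `|a p|) b) => // p.
  exact: le_trans (normr_ge0 _) (ab p).
split=> // N.
have h1 : (fun M => `|series a M - series a N|) @ \oo -->
    `|limn (series a) - series a N|.
  by apply: cvg_norm; apply: cvgB => //; exact: cvg_cst.
have h2 : (fun M => series b M - series b N) @ \oo --> limn (series b) - series b N.
  by apply: cvgB => //; exact: cvg_cst.
apply: (ler_cvg_to h1 h2); exists N => // M /= NM.
rewrite !sub_series_geq//.
by apply: le_trans (ler_norm_sum _ _ _) _; exact: ler_sum.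
Qed.

Lemma cbasisE (R : realType) (L : R) (p : nat) (x : R) :
  cbasis L p x = (if p == 0%N then 1 else Num.sqrt 2) * cosk L p x.
Proof.
rewrite /cbasis /cosk; case: eqP => [->|//].
by rewrite !mul0r cos0 mulr1.
Qed.

Lemma cbasis_continuous (R : realType) (L : R) (p : nat) (A : set R) :
  {within A, continuous (cbasis L p)}.
Proof.
rewrite (_ : cbasis L p =
    fun x => (if p == 0%N then 1 else Num.sqrt 2) * cosk L p x); last first.
  by apply/funext => x; exact: cbasisE.
apply: within_continuousM; last exact: cosk_continuous.
by move=> x; exact: cst_continuous.
Qed.

Lemma sqrt2_le2 (R : realType) : Num.sqrt 2 <= 2 :> R.
Proof.
rewrite -[leRHS]ger0_norm// -sqrtr_sqr ler_sqrt ?sqr_ge0//.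
by rewrite expr2; lra.
Qed.

Lemma cbasis_le2 (R : realType) (L : R) (p : nat) (x : R) : `|cbasis L p x| <= 2.
Proof.
rewrite cbasisE normrM -[leRHS]mulr1.
rewrite ler_pM ?cos_max//; case: eqP => _; first by rewrite normr1; lra.
by rewrite ger0_norm ?sqrtr_ge0// sqrt2_le2.
Qed.

Lemma Int_cbasisM (R : realType) (L : R) (p k : nat) : 0 < L ->
  Int L (fun x => cbasis L p x * cbasis L k x) = (p == k)%:R * L.
Proof.
move=> L0.
set w := fun p : nat => if p == 0%N then 1 else Num.sqrt 2 : R.
transitivity (Int L (fun x => (w p * w k / 2) * cosk L (p + k) x +
    (w p * w k / 2) * cosk L (maxn p k - minn p k) x)).
  apply: eq_Rintegral => x _; rewrite !cbasisE -/(w p) -/(w k).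
  transitivity ((w p * w k) * (cosk L p x * cosk L k x)); first by ring.
  by rewrite coskM; ring.
rewrite Int_lin; [|exact: cosk_continuous..].
rewrite !Int_cosk// addn_eq0.
have -> : (maxn p k - minn p k == 0)%N = (p == k) by lia.
have [<-|pk] := eqVneq p k.
  rewrite andbb /w; case: eqP => _; first by rewrite !mul1r; field.
  by rewrite -expr2 sqr_sqrtr// mulr0n mul0r mulr0 add0r; field.
have -> : (p == 0)%N && (k == 0)%N = false by lia.
by rewrite mulr0n !mul0r !mulr0 addr0.
Qed.

Lemma Int_norm_le (R : realType) (L e : R) (f : R -> R) : 0 < L ->
  {within `[0, L], continuous f} ->
  (forall x, 0 < x -> x < L -> `|f x| <= e) -> `|Int L f| <= e * L.
Proof.
move=> L0 cf fe; have cc (c : R) : {within `[0, L], continuous (fun=> c)}.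
  by move=> x; exact: cst_continuous.
rewrite ler_norml -mulNr -!Int_cst//; apply/andP; split.
  by apply: Int_le => // x x0 xL; have := fe x x0 xL; rewrite ler_norml => /andP[].
by apply: Int_le => // x x0 xL; have := fe x x0 xL; rewrite ler_norml => /andP[].
Qed.

Lemma series_cbasis_continuous (R : realType) (L : R) (c : R^nat) (N : nat) (A : set R) :
  {within A, continuous (fun x => series (fun p => c p * cbasis L p x) N)}.
Proof.
elim: N => [|N IH].
  rewrite (_ : (fun x => _) = fun=> 0); first by move=> x; exact: cst_continuous.
  by apply/funext => x; rewrite /series /= big_nil.
rewrite (_ : (fun x => _) =
    fun x => 1 * series (fun p => c p * cbasis L p x) N + c N * cbasis L N x).
  by apply: within_continuous_lin => //; exact: cbasis_continuous.
by apply/funext => x; rewrite /series /= big_nat_recr//= mul1r.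
Qed.

Lemma Int_series_cbasisM (R : realType) (L : R) (c : R^nat) (N k : nat) : 0 < L ->
  Int L (fun x => series (fun p => c p * cbasis L p x) N * cbasis L k x) =
  if (k < N)%N then c k * L else 0.
Proof.
move=> L0; elim: N => [|N IH].
  rewrite -(mul0r L) -(Int_cst _ _ 0 L0); apply: eq_Rintegral => x _.
  by rewrite /series /= big_nil mul0r.
transitivity (Int L (fun x => 1 * (series (fun p => c p * cbasis L p x) N * cbasis L k x) +
   c N * (cbasis L N x * cbasis L k x))).
  by apply: eq_Rintegral => x _; rewrite /series /= big_nat_recr//=; ring.
rewrite Int_lin; [|apply: within_continuousM; [|exact: cbasis_continuous]..].
- rewrite IH Int_cbasisM// mul1r ltnS [in RHS]leq_eqVlt.
  have [<-|_] := eqVneq k N; first by rewrite ltnn mul1r add0r.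
  by rewrite mul0r mulr0 addr0.
- exact: series_cbasis_continuous.
- exact: cbasis_continuous.
Qed.

Lemma cosine_series_cvg (R : realType) (L : R) (u : R -> R) (x : R) : 0 < L ->
  {within `[0, L], continuous u} ->
  cvgn (series (fun p => `|alpha L u p|)) -> 0 <= x <= L ->
  series (fun p => alpha L u p * cbasis L p x) @ \oo --> u x.
Proof.
move=> L0 cu ca xL.
pose b p := 2 * `|alpha L u p|.
have cb : cvgn (series b) by exact: is_cvg_seriesZ ca.
pose S N y := series (fun p => alpha L u p * cbasis L p y) N.
have Sdom y p : `|alpha L u p * cbasis L p y| <= b p.
  by rewrite normrM mulrC ler_wpM2r// cbasis_le2.
pose f y := limn (series (fun p => alpha L u p * cbasis L p y)).
pose t N := limn (series b) - series b N.
have Sf y N : `|f y - S N y| <= t N.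
  by have [_] := series_dominated _ _ _ (Sdom y) cb; exact.
have t0 e : 0 < e -> exists N0, forall N, (N0 <= N)%N -> t N < e.
  move=> e0; have /cvgrPdist_lt /(_ e e0) [N0 _ H] : series b @ \oo --> limn (series b) by [].
  by exists N0 => N N0N; apply: le_lt_trans (H N N0N); exact: ler_norm.
have cS N : {within `[0, L], continuous (S N)} by exact: series_cbasis_continuous.
(* A uniform limit of continuous partial sums, by splitting [e] into thirds. *)
have cf : {within `[0, L], continuous f}.
  apply/subspace_continuousP => y yA; apply/cvgrPdist_lt => e e0.
  have e3 : 0 < e / 3 by rewrite divr_gt0.
  have [N0 /(_ N0 (leqnn _)) tN0] := t0 _ e3.
  have /subspace_continuousP/(_ y yA)/cvgrPdist_lt/(_ _ e3) := cS N0.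
  apply: filterS => z Hz.
  have -> : f y - f z = (f y - S N0 y) + (S N0 y - S N0 z) - (f z - S N0 z) by ring.
  apply: le_lt_trans (ler_normB _ _) _.
  have -> : e = e / 3 + e / 3 + e / 3 by field.
  apply: ltrD; last exact: le_lt_trans (Sf z N0) tN0.
  by apply: le_lt_trans (ler_normD _ _) _; apply: ltrD => //; exact: le_lt_trans (Sf y N0) tN0.
have oh : cos_orth L (fun y => 1 * u y + (-1) * f y).
  split; first exact: within_continuous_lin.
  have ch := within_continuous_lin _ _ _ _ 1 (-1) cu cf.
  suff H k : Int L (fun y => (1 * u y + (-1) * f y) * cbasis L k y) = 0.
    move=> k; set w : R := if k == 0%N then 1 else Num.sqrt 2.
    have w0 : w != 0 by rewrite /w; case: ifP => _; rewrite ?oner_eq0// gt_eqF// sqrtr_gt0.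
    transitivity (Int L (fun y => w^-1 * ((1 * u y + (-1) * f y) * cbasis L k y)
        + 0 * ((1 * u y + (-1) * f y) * cbasis L k y))).
      apply: eq_Rintegral => y _; rewrite cbasisE -/w mul0r addr0.
      by field.
    rewrite Int_lin; first by rewrite H !mulr0 addr0.
    - by apply: within_continuousM => //; exact: cbasis_continuous.
    - by apply: within_continuousM => //; exact: cbasis_continuous.
  apply/eqP; rewrite -normr_le0; apply/ler_addgt0Pr => e e0.
  rewrite add0r.
  have [N0 HN0] := t0 (e / (2 * L)) (divr_gt0 e0 (mulr_gt0 (ltr0Sn _ 1) L0)).
  (* Beyond index [k] the partial sum has the same [k]-th coefficient as [u], so only the uniformly
     small remainder [S N - f] is left in the integral. *)
  pose N := maxn N0 k.+1.
  have tN : t N < e / (2 * L) by apply: HN0; rewrite leq_maxl.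
  have uS : Int L (fun y => 1 * (u y * cbasis L k y) + (-1) * (S N y * cbasis L k y)) = 0.
    rewrite Int_lin; [|apply: within_continuousM => //; exact: cbasis_continuous..].
    rewrite Int_series_cbasisM// /N leq_maxr /alpha /ip mulrAC mulVf ?gt_eqF//.
    by rewrite !mul1r mulN1r subrr.
  have -> : Int L (fun y => (1 * u y + (-1) * f y) * cbasis L k y) =
      Int L (fun y => (S N y - f y) * cbasis L k y).
    transitivity (Int L (fun y =>
        1 * (1 * (u y * cbasis L k y) + (-1) * (S N y * cbasis L k y)) +
        1 * ((S N y - f y) * cbasis L k y))).
      by apply: eq_Rintegral => y _; ring.
    rewrite Int_lin; first by rewrite uS mulr0 add0r mul1r.
    - by apply: within_continuous_lin; apply: within_continuousM => //;
        exact: cbasis_continuous.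
    - apply: within_continuousM; last exact: cbasis_continuous.
      exact: within_continuousB.
  apply: (@le_trans _ _ ((t N * 2) * L)); last first.
    move: tN; rewrite ltr_pdivlMr ?mulr_gt0// => /ltW; lra.
  apply: Int_norm_le => //.
    apply: within_continuousM; last exact: cbasis_continuous.
    exact: within_continuousB.
  move=> y _ _; rewrite normrM ler_pM ?cbasis_le2// distrC; exact: Sf.
have /eqP := cos_orth_eq0 _ _ _ x L0 oh xL.
rewrite mul1r mulN1r subr_eq0 => /eqP ->.
by have [] := series_dominated _ _ _ (Sdom x) cb.
Qed.

(** * Comparison of the solution with the scheme *)

Definition midpoint {R : realType} (L : R) (J j : nat) : R :=
  L * (2 * j%:R + 1) / (2 * J%:R).

(* The midpoint samples, continued beyond the grid, are symmetric about both
   ends, so the boundary rows act like interior ones. *)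
Lemma Pdelta_cbasis (R : realType) (L dx : R) (J p : nat) :
  0 < L -> (2 <= J)%N ->
  Pdelta J dx *m \col_j cbasis L p (midpoint L J j) =
  (- (4 / dx ^+ 2 * sin (p%:R * pi / (2 * J%:R)) ^+ 2)) *:
    \col_j cbasis L p (midpoint L J j).
Proof.
move=> L0 J2; set a := p%:R * pi / _.
have J0 : J%:R != 0 :> R by rewrite pnatr_eq0; lia.
set W : R := if p == 0%N then 1 else Num.sqrt 2.
pose w j := cbasis L p (midpoint L J j).
have wE j : w j = W * cos (a * (2 * j%:R + 1)).
  rewrite /w cbasisE -/W /cosk /midpoint /a; congr (_ * cos _).
  by field; rewrite J0 gt_eqF.
apply/matrixP => i k; rewrite ord1 (Pdelta_mul _ _ _ w) // [RHS]mxE [X in _ = _ * X]mxE -/(w i).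
set ph := a * (2 * i%:R + 1).
have up : (if (i.+1 < J)%N then w i.+1 - w i else 0) = W * (cos (ph + 2 * a) - cos ph).
  case: ltnP => iJ.
    rewrite !wE mulrBr; congr (W * cos _ - _).
    by rewrite /ph -natr1; ring.
  have {}iJ : i.+1 = J by have := ltn_ord i; lia.
  have iE : i%:R = J%:R - 1 :> R.
    have : i.+1%:R = J%:R :> R by rewrite iJ.
    by rewrite -natr1 => <-; rewrite addrK.
  (* In the last row the two phases are mirror images about [p%:R * pi], so the difference of
     cosines is zero, as the missing neighbour requires. *)
  have -> : ph + 2 * a = p%:R * pi + a by rewrite /ph iE /a; field.
  have -> : ph = p%:R * pi - a by rewrite /ph iE /a; field.
  by rewrite cosD cosB sin_natr_pi !mul0r; ring.
have down : (if (0 < i)%N then w i.-1 - w i else 0) = W * (cos (ph - 2 * a) - cos ph).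
  case: posnP => i0.
    rewrite /ph i0 mulr0 add0r mulr1 (_ : a - 2 * a = - a); last by ring.
    by rewrite cosN subrr mulr0.
  rewrite !wE mulrBr; congr (W * cos _ - _).
  have iE : i%:R = i.-1%:R + 1 :> R by rewrite natr1 prednK.
  by rewrite /ph iE; ring.
rewrite up down wE -/ph cosD cosB (_ : 2 * a = a *+ 2); last by rewrite mulr_natl.
by rewrite cos_mulr2n cos2sin2; ring.
Qed.

(** The phases differ by [p / K * (pi / 2)] times [(2 * j - K) / (K + 1)], which lies in [-1, 1].
    The constant is 2 for the normalisation times 2 for [pi / 2]. *)
Lemma cbasis_nodes_dist (R : realType) (L : R) (p K j : nat) : 0 < L ->
  (0 < K)%N -> (j <= K)%N ->
  `|cbasis L p (j%:R * (L / K%:R)) - cbasis L p (midpoint L K.+1 j)|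
  <= 4 * (p%:R / K%:R).
Proof.
move=> L0 K0 jK.
have K0' : 0 < K%:R :> R by rewrite ltr0n.
rewrite !cbasisE -mulrBr normrM.
have w2 : `|if p == 0%N then 1 else Num.sqrt 2| <= 2 :> R.
  case: eqP => _; first by rewrite normr1; lra.
  by rewrite ger0_norm ?sqrtr_ge0// sqrt2_le2.
apply: (@le_trans _ _ (2 * (2 * (p%:R / K%:R)))); last by lra.
apply: ler_pM => //; apply: le_trans (cos_lipschitz _ _ _) _.
have -> : p%:R * pi * (j%:R * (L / K%:R)) / L - p%:R * pi * midpoint L K.+1 j / L
   = (p%:R / K%:R) * (pi / 2) * ((2 * j%:R - K%:R) / (K%:R + 1)).
  rewrite /midpoint -natr1; field.
  by rewrite !gt_eqF// ltr_wpDl.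
have jK' : j%:R <= K%:R :> R by rewrite ler_nat.
have j0 : 0 <= j%:R :> R by [].
have pK : 0 <= p%:R / K%:R :> R by rewrite divr_ge0.
have pi4 := @pi_le4 R; have pi0 := @pi_ge0 R.
rewrite normrM -[leRHS]mulr1 ler_pM//.
  rewrite normrM (ger0_norm pK) mulrC ler_wpM2r// ger0_norm ?divr_ge0//; lra.
rewrite normrM [X in _ * X]ger0_norm ?invr_ge0; last by lra.
rewrite ler_pdivrMr ?mul1r; last by lra.
rewrite ler_norml; lra.
Qed.

Lemma l2norm_cvg (R : realType) (J : nat) (u : nat -> 'cV[R]_J) (w : 'cV[R]_J) :
  (forall j, (fun N => u N j ord0) @ \oo --> w j ord0) ->
  (fun N => l2norm (u N)) @ \oo --> l2norm w.
Proof.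
move=> uw.
suff h : (fun N => J%:R^-1 * \sum_(j < J) u N j ord0 ^+ 2) @ \oo -->
    J%:R^-1 * \sum_(j < J) w j ord0 ^+ 2.
  exact: (cvg_comp _ _ h (@sqrt_continuous _ _)).
apply: cvgM; first exact: cvg_cst.
apply: cvg_big => [|j _]; first exact: add_continuous.
by apply: cvgM; exact: uw.
Qed.

Lemma euler_contract (R : realType) (J : nat) (A : 'M[R]_J)
    (z v : nat -> 'cV[R]_J) :
  (forall w, l2norm (A *m w) <= l2norm w) ->
  (forall n, z n.+1 = A *m z n) -> (forall n, v n.+1 = A *m v n) ->
  forall n, l2norm (z n - v n) <= l2norm (z 0%N - v 0%N).
Proof.
move=> Ac zS vS; elim=> [//|n IH].
by rewrite zS vS -mulmxBr; exact: le_trans (Ac _) IH.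
Qed.

(** For [p >= 1] the weights 1 and [p] are at most [p ^ 4]. The term [p = 0], absent from the
    hypothesis, is added to the first bound and has weight 0 in the second sum. *)
Lemma nneseries_weighted_cvg (R : realType) (a : R^nat) :
  (\sum_(1 <= p <oo) (`|a p| * p%:R ^+ 4)%:E < +oo)%E ->
  cvgn (series (fun p => `|a p|)) /\
  forall N, \sum_(0 <= p < N) `|a p| * p%:R <=
    fine (\sum_(1 <= p <oo) (`|a p| * p%:R ^+ 4)%:E)%E.
Proof.
set T := (X in (X < _)%E) => Tfin.
have T0 : (0 <= T)%E.
  by apply: nneseries_ge0 => p _ _; rewrite lee_fin mulr_ge0// exprn_ge0.
have TS : T = (fine T)%:E by rewrite fineK// ge0_fin_numE.
have part N : \sum_(1 <= p < N) `|a p| * p%:R ^+ 4 <= fine T.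
  rewrite -lee_fin -TS -sumEFin; apply: nneseries_lim_ge => p _ _.
  by rewrite lee_fin mulr_ge0// exprn_ge0.
have p4 p : (0 < p)%N -> 1 <= p%:R ^+ 3 :> R.
  by move=> p0; rewrite exprn_ege1// ler1n.
have fT0 : 0 <= fine T by exact: fine_ge0.
split=> [|[|N]].
- apply: nondecreasing_is_cvgn.
    by apply: nondecreasing_series => p _ _.
  exists (`|a 0%N| + fine T) => _ [[|N] _ <-].
    by rewrite /series /= big_nil addr_ge0.
  rewrite /series /= big_ltn//= lerD2l; apply: le_trans (part N.+1).
  apply: ler_sum_nat => p /andP[p0 _].
  rewrite ler_peMr// exprSr -[leLHS]mulr1 ler_pM ?p4// ?ler1n//.
- by rewrite big_nil.
- rewrite big_ltn//= mulr0 add0r; apply: le_trans (part N.+1).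
  apply: ler_sum_nat => p /andP[p0 _].
  by rewrite ler_wpM2l// exprSr ler_peMl// p4.
Qed.

Lemma mode_dist (R : realType) (L dt : R) (p K n j : nat) : 0 < L -> 0 < dt ->
  dt / (L / K%:R) ^+ 2 <= 2^-1 -> (0 < K)%N -> (j <= K)%N ->
  `|expR (- (p%:R ^+ 2 * pi ^+ 2 * (n%:R * dt) / L ^+ 2)) *
      cbasis L p (j%:R * (L / K%:R)) -
    (1 - dt * (4 / (L / K%:R) ^+ 2 * sin (p%:R * pi / (2 * K.+1%:R)) ^+ 2)) ^+ n *
      cbasis L p (midpoint L K.+1 j)| <= 34 * (p%:R / K%:R).
Proof.
move=> L0 dt0 cfl K0 jK.
set r := dt / _ in cfl.
have Kp : 0 < K%:R :> R by rewrite ltr0n.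
have r0 : 0 <= r by rewrite divr_ge0 ?sqr_ge0// ltW.
have -> : expR (- (p%:R ^+ 2 * pi ^+ 2 * (n%:R * dt) / L ^+ 2)) =
    expR (- (r * (p%:R * pi / K%:R) ^+ 2)) ^+ n.
  rewrite -expRM_natl; congr expR; rewrite /r.
  by field; rewrite !gt_eqF.
set s2 := sin _ ^+ 2.
have -> : dt * (4 / (L / K%:R) ^+ 2 * s2) = 4 * r * s2 by rewrite /r; ring.
set a := expR _; set b := 1 - _; set c := cbasis L p _; set c' := cbasis L p _.
case: (posnP p) => [p0|p0].
  rewrite /a /b /c /c' /s2 p0 !mul0r sin0 !expr0n /= !mulr0 oppr0 expR0 addr0.
  by rewrite /cbasis /= subrr normr0.
have s0 : 0 <= s2 by exact: sqr_ge0.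
have s1 : s2 <= 1.
  by rewrite /s2 sin2cos2 lerBlDr lerDl sqr_ge0.
have rs0 : 0 <= r * s2 by rewrite mulr_ge0.
have rs1 : r * s2 <= 2^-1 by rewrite -[leRHS]mulr1 ler_pM.
have b1 : `|b ^+ n| <= 1.
  by rewrite normrX exprn_ile1// ler_norml /b; apply/andP; split; lra.
have hab : `|a ^+ n - b ^+ n| <= 15 * (p%:R / K%:R) by exact: mode_decay_dist.
have hcc : `|c - c'| <= 4 * (p%:R / K%:R) by exact: cbasis_nodes_dist.
have c2 : `|c| <= 2 by exact: cbasis_le2.
(* The constant is [34 = 15 * 2 + 1 * 4]: decay error times the bound on [c], plus a bounded power
   times the shift of the sample point. *)
have -> : a ^+ n * c - b ^+ n * c' = (a ^+ n - b ^+ n) * c + b ^+ n * (c - c') by ring.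
apply: le_trans (ler_normD _ _) _; rewrite !normrM.
have := ler_pM (normr_ge0 _) (normr_ge0 _) hab c2.
have := ler_pM (normr_ge0 _) (normr_ge0 _) b1 hcc.
lra.
Qed.

Lemma ler_norm_sum_weighted (R : realDomainType) (N : nat) (a x y : nat -> R) (C S : R) :
  0 <= C -> (forall p, `|x p - y p| <= C * p%:R) ->
  \sum_(0 <= p < N) `|a p| * p%:R <= S ->
  `|\sum_(0 <= p < N) a p * x p - \sum_(0 <= p < N) a p * y p| <= C * S.
Proof.
move=> C0 xy aS; rewrite -sumrB.
apply: le_trans (ler_norm_sum _ _ _) _.
apply: le_trans (ler_wpM2l C0 aS); rewrite mulr_sumr.
apply: ler_sum => p _; rewrite -mulrBr normrM mulrCA.
by rewrite ler_wpM2l.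
Qed.

Lemma heat_euler_dist (R : realType) (L dt S : R) (u : R -> R) (K : nat)
    (v : nat -> 'cV[R]_K.+1) (n : nat) :
  0 < L -> (0 < K)%N -> 0 < dt -> dt / (L / K%:R) ^+ 2 <= 2^-1 ->
  {within `[0, L], continuous u} ->
  (forall n, v n.+1 = (1%:M + dt *: Pdelta K.+1 (L / K%:R)) *m v n) ->
  cvgn (series (fun p => `|alpha L u p|)) ->
  (forall N, \sum_(0 <= p < N) `|alpha L u p| * p%:R <= S) ->
  l2norm (Pi_dx K.+1 (L / K%:R) (heat_sol L u (n%:R * dt)) - v n) <=
  l2norm (Pi_dx K.+1 (L / K%:R) u - v 0%N) + 38 * (S / K%:R).
Proof.
move=> L0 K0 dt0 cfl cu vS ca aS.
set dx := L / K%:R in cfl vS *.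
have Kp : 0 < K%:R :> R by rewrite ltr0n.
have S0 : 0 <= S by have := aS 0%N; rewrite big_nil.
pose al p := alpha L u p.
pose E p := expR (- (p%:R ^+ 2 * pi ^+ 2 * (n%:R * dt) / L ^+ 2)).
pose mu p := 1 - dt * (4 / dx ^+ 2 * sin (p%:R * pi / (2 * K.+1%:R)) ^+ 2).
pose e p : 'cV[R]_K.+1 := \col_j cbasis L p (midpoint L K.+1 j).
pose A : 'M[R]_K.+1 := 1%:M + dt *: Pdelta K.+1 dx.
(* All three families are truncated at [N]: [z] is an exact orbit of the scheme, [U] samples the
   solution at the nodes, and [B] the initial datum. The distances 34 from [U] to [z] and 4 from [z]
   to [B] add up to 38, and [N] then tends to infinity. *)
pose z N m : 'cV[R]_K.+1 := \sum_(0 <= p < N) (al p * mu p ^+ m) *: e p.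
pose U N : 'cV[R]_K.+1 :=
  \col_j \sum_(0 <= p < N) al p * E p * cbasis L p (j%:R * dx).
pose B N : 'cV[R]_K.+1 :=
  \col_j \sum_(0 <= p < N) al p * cbasis L p (j%:R * dx).
have zE N m j : z N m j ord0 =
    \sum_(0 <= p < N) al p * (mu p ^+ m * cbasis L p (midpoint L K.+1 j)).
  by rewrite summxE; apply: eq_bigr => p _; rewrite !mxE mulrA.
have zS N m : z N m.+1 = A *m z N m.
  rewrite /z mulmx_sumr; apply: eq_bigr => p _.
  rewrite -scalemxAr /A mulmxDl mul1mx -scalemxAl Pdelta_cbasis// -/(e p).
  rewrite scalerA -[X in X + _]scale1r -scalerDl scalerA; congr (_ *: _).
  by rewrite exprSr /mu; ring.
have Ac w : l2norm (A *m w) <= l2norm w by apply: l2norm_euler_step => //; exact: ltW.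
have jK (j : 'I_K.+1) : (j <= K)%N by rewrite -ltnS.
have Uz N : l2norm (U N - z N n) <= 34 / K%:R * S.
  apply: l2norm_le; first by rewrite mulr_ge0// divr_ge0.
  move=> j; rewrite [X in `|X|]mxE [X in `|_ + X|]mxE zE [U N _ _]mxE.
  under eq_bigr => p _ do rewrite -mulrA.
  apply: ler_norm_sum_weighted (aS N) => [|p]; first by rewrite divr_ge0.
  by rewrite mulrAC -mulrA; exact: mode_dist.
have zB N : l2norm (z N 0%N - B N) <= 4 / K%:R * S.
  apply: l2norm_le; first by rewrite mulr_ge0// divr_ge0.
  move=> j; rewrite [X in `|X|]mxE [X in `|_ + X|]mxE zE [B N _ _]mxE.
  apply: ler_norm_sum_weighted (aS N) => [|p]; first by rewrite divr_ge0.
  by rewrite expr0 mul1r distrC mulrAC -mulrA; exact: cbasis_nodes_dist.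
have key N : l2norm (U N - v n) <= l2norm (B N - v 0%N) + 38 * (S / K%:R).
  have -> : U N - v n = (U N - z N n) + (z N n - v n) by rewrite addrA subrK.
  apply: le_trans (l2normD _ _ _ _) _.
  have h := euler_contract _ _ _ _ _ Ac (zS N) vS n.
  have hB : l2norm (z N 0%N - v 0%N) <= l2norm (z N 0%N - B N) + l2norm (B N - v 0%N).
    by rewrite -{1}(subrK (B N) (z N 0%N)) -addrA l2normD.
  have := Uz N; have := zB N; move: h hB.
  have -> : 34 / K%:R * S = 34 * (S / K%:R) by ring.
  have -> : 4 / K%:R * S = 4 * (S / K%:R) by ring.
  lra.
have cU : (fun N => l2norm (U N - v n)) @ \oo -->
    l2norm (Pi_dx K.+1 dx (heat_sol L u (n%:R * dt)) - v n).
  apply: l2norm_cvg => j.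
  rewrite (_ : (fun N => _) =
      fun N => \sum_(0 <= p < N) al p * E p * cbasis L p (j%:R * dx) - v n j ord0); last first.
    by apply/funext => N; rewrite !mxE.
  rewrite (_ : (_ - v n) j ord0 = heat_sol L u (n%:R * dt) (j%:R * dx) - v n j ord0); last by rewrite !mxE.
  apply: cvgB; last exact: cvg_cst.
  have cb : cvgn (series (fun p => 2 * `|al p|)) by exact: is_cvg_seriesZ ca.
  apply: (series_dominated _ _ _ _ cb).1 => p.
  rewrite !normrM mulrC; apply: ler_pM; rewrite ?mulr_ge0// ?cbasis_le2//.
  rewrite ler_piMr//.
  rewrite ger0_norm ?expR_ge0// -expR0 ler_expR oppr_le0.
  by rewrite divr_ge0 ?sqr_ge0//; do 2?[apply: mulr_ge0]; rewrite ?sqr_ge0 ?(ltW dt0).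
(* Here the cosine series must return the values of [u] itself at the nodes, endpoints included. *)
have cB : (fun N => l2norm (B N - v 0%N)) @ \oo --> l2norm (Pi_dx K.+1 dx u - v 0%N).
  apply: l2norm_cvg => j.
  rewrite (_ : (fun N => _) =
      fun N => \sum_(0 <= p < N) al p * cbasis L p (j%:R * dx) - v 0%N j ord0); last first.
    by apply/funext => N; rewrite !mxE.
  rewrite (_ : (_ - v 0%N) j ord0 = u (j%:R * dx) - v 0%N j ord0); last by rewrite !mxE.
  apply: cvgB; last exact: cvg_cst.
  apply: cosine_series_cvg => //.
  rewrite mulr_ge0 ?divr_ge0 ?(ltW L0)//= /dx mulrCA ler_piMr ?(ltW L0)//.
  by rewrite ler_pdivrMr// mul1r ler_nat.
apply: (ler_cvg_to cU (cvgD cB (cvg_cst _))).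
by apply: nearW => N; exact: key.
Qed.

Theorem theorem2p12 (R : realType) (L : R) (hL : 0 < L) :
  exists C : R, 0 < C /\
  forall (g : nat -> R -> R),
    (* u0 = g 0%N in H^6(0,L) with weak derivatives g 1, ..., g 6%N *)
    sobolev_chain L 6 g ->
    (* continuous representatives of u0 and of its derivatives up to order 5 *)
    (forall i, (i <= 5)%N -> {within `[0, L], continuous (g i)}) ->
    (* u0 in Dom(P), P u0 in Dom(P), P^2 u0 in Dom(P) (Neumann conditions) *)
    g 1%N 0 = 0 -> g 1%N L = 0 ->
    g 3%N 0 = 0 -> g 3%N L = 0 ->
    g 5%N 0 = 0 -> g 5%N L = 0 ->
  forall (J : nat) (dt : R), (2 <= J)%N -> 0 < dt -> dt < 1 ->
    dt / (dx_of L J) ^+ 2 <= 2^-1 ->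
  forall v : nat -> 'cV[R]_J,
    (forall n, v n.+1 = (1%:M + dt *: Pdelta J (dx_of L J)) *m v n) ->
  forall n : nat, (1 <= n)%N ->
    ((l2norm (Pi_dx J (dx_of L J) (heat_sol L (g 0%N) (n%:R * dt)) - v n))%:E <=
     (l2norm (Pi_dx J (dx_of L J) (g 0%N) - v 0%N))%:E +
     C%:E * ((dx_of L J)%:E *
               (\sum_(1 <= p <oo) (`|alpha L (g 0%N) p| * (p%:R) ^+ 4)%:E)
             + (dt * H1norm L (g 4%N) (g 5%N))%:E))%E.
Proof.
have C0 : 0 < 38 / L by rewrite divr_gt0.
(* With [dx = L / K], the bound [38 * (S / K)] equals [38 / L * (dx * S)]. *)
exists (38 / L); split=> // g _ cg _ _ _ _ _ _ [//|K] dt K1 dt0 _ cfl v vS n _.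
set T := (\sum_(1 <= p <oo) _)%E; set H := H1norm _ _ _.
have K0 : (0 < K)%N by [].
have Kp : 0 < K%:R :> R by rewrite ltr0n.
have dx0 : 0 < dx_of L K.+1 by rewrite divr_gt0.
have T0 : (0 <= T)%E.
  by apply: nneseries_ge0 => p _ _; rewrite lee_fin mulr_ge0// exprn_ge0.
(* If the weighted sum diverges, the right-hand side is infinite. *)
have [Tfin|] := ltP T +oo%E; last first.
  rewrite leye_eq => /eqP ->.
  rewrite gt0_muley ?lte_fin// addye// gt0_muley ?lte_fin// addey//.
  exact: leey.
have [ca aS] := nneseries_weighted_cvg _ _ Tfin.
have := heat_euler_dist _ _ _ _ (g 0%N) _ v n hL K0 dt0 cfl (cg 0%N isT) vS ca aS.
rewrite -/T => h.
have [S TS] : exists S : R, T = S%:E.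
  by exists (fine T); rewrite fineK// ge0_fin_numE.
rewrite TS /= in h *.
rewrite -[leRHS]/((l2norm (Pi_dx K.+1 (dx_of L K.+1) (g 0%N) - v 0%N) +
  38 / L * (dx_of L K.+1 * S + dt * H))%:E) lee_fin.
apply: le_trans h _; rewrite lerD2l.
have H0 : 0 <= 38 / L * (dt * H) by rewrite mulr_ge0 ?(ltW C0)// mulr_ge0 ?sqrtr_ge0// ltW.
rewrite mulrDr (_ : 38 / L * (dx_of L K.+1 * S) = 38 * (S / K%:R)).
  by rewrite lerDl.
rewrite /dx_of /=; field.
by rewrite !gt_eqF.
Qed.
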